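(* Let $\mathcal{L}\subseteq\mathbb{R}^2$ be a rotatable lattice, let $S\subseteq\mathcal{L}$ be finite and let $s_0$ be an extreme point of $S$. Then for every $k\in\mathbb{N}$ there is a constant $\Lambda=\Lambda(\mathcal{L},S,k)$ such that every $k$-colouring of $\mathcal{L}$ contains either an almost-monochromatic similar copy of $(S,s_0)$ (contained in $\mathcal{L}$) with positive scaling factor at most $\Lambda$, or a monochromatic positive homothetic copy $c+\lambda\mathcal{L}\subseteq\mathcal{L}$ of $\mathcal{L}$ with an integer scaling factor $1\le\lambda\le\Lambda$.
   Context: A lattice generated by linearly independent $v_1,v_2\in\mathbb{R}^2$ is $\mathcal{L}=\{n_1v_1+n_2v_2:n_1,n_2\in\mathbb{Z}\}$. It is rotatable if for every $0\le\alpha_1<\alpha_2\le\pi$ there are an angle $\alpha\in(\alpha_1,\alpha_2)$ and a scaling factor $\lambda>0$ such that $\lambda\,\rho_\alpha(\mathcal{L})\subseteq\mathcal{L}$, where $\rho_\alpha$ is rotation by $\alpha$ about the origin. $s_0$ is an extreme point of $S$ if $s_0\notin\operatorname{conv}(S\setminus\{s_0\})$. A similar copy of $(S,s_0)$ is $(f(S),f(s_0))$ with $f(x)=\lambda Qx+c$, $\lambda>0$ the scaling factor, $Q$ orthogonal. A pair $(T,t_0)$ is almost-monochromatic if $T\setminus\{t_0\}$ is monochromatic but $T$ is not.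
   Formalization: S is assumed to have at least two points; for S = {s_0} no copy can be almost-monochromatic, and for k ≥ 2 some colourings of the lattice contain no monochromatic copy c + λL with integer λ ≥ 1, so the claim fails there. *)

(* Defs.v *)
From HB Require Import structures.
From mathcomp Require Import all_boot all_order all_algebra.
From mathcomp Require Import all_classical all_reals all_analysis.

Set Implicit Arguments.
Unset Strict Implicit.
Unset Printing Implicit Defensive.

Import Order.TTheory GRing.Theory Num.Theory.
Import numFieldNormedType.Exports.

Local Open Scope classical_set_scope.
Local Open Scope ring_scope.

Definition lattice (R : realType) (v1 v2 : 'cV[R]_2) : set 'cV[R]_2 :=
  [set x | exists n1 n2 : int, x = v1 *~ n1 + v2 *~ n2].

Definition is_lattice (R : realType) (L : set 'cV[R]_2) : Prop :=
  exists v1 v2 : 'cV[R]_2, free [:: v1; v2] /\ L = lattice v1 v2.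

Definition rotation_mx (R : realType) (a : R) : 'M[R]_2 :=
  \matrix_(i, j) if i == j then cos a else if i == 0 then - sin a else sin a.

Definition rotatable (R : realType) (L : set 'cV[R]_2) : Prop :=
  forall a1 a2 : R, 0 <= a1 -> a1 < a2 -> a2 <= pi ->
  exists a lam : R, [/\ a1 < a < a2, 0 < lam &
    [set lam *: (rotation_mx a *m x) | x in L] `<=` L].

Definition convex_hull (R : realType) (A : set 'cV[R]_2) : set 'cV[R]_2 :=
  smallest (@convex_set R 'cV[R]_2) A.

Definition extreme_point (R : realType) (S : set 'cV[R]_2) (s0 : 'cV[R]_2) :
    Prop :=
  S s0 /\ ~ convex_hull (S `\ s0) s0.

Definition orthogonal_mx (R : realType) (Q : 'M[R]_2) : Prop :=
  Q^T *m Q = 1%:M.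

(* [(T, t0)] is a similar copy of [(S, s0)] with scaling factor [lam]. *)
Definition similar_copy (R : realType) (S : set 'cV[R]_2) (s0 : 'cV[R]_2)
    (lam : R) (T : set 'cV[R]_2) (t0 : 'cV[R]_2) : Prop :=
  0 < lam /\
  exists (Q : 'M[R]_2) (c : 'cV[R]_2), let f x := lam *: (Q *m x) + c in
    [/\ orthogonal_mx Q, T = f @` S & t0 = f s0].

(* The colouring [chi] is defined on the points of [L] only, so these two
   notions are meant for sets [T] contained in [L]. *)
Definition monochromatic (R : realType) (L : set 'cV[R]_2) (k : nat)
    (chi : L -> 'I_k) (T : set 'cV[R]_2) : Prop :=
  forall x y : L, T (val x) -> T (val y) -> chi x = chi y.

Definition almost_monochromatic (R : realType) (L : set 'cV[R]_2) (k : nat)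
    (chi : L -> 'I_k) (T : set 'cV[R]_2) (t0 : 'cV[R]_2) : Prop :=
  monochromatic chi (T `\ t0) /\ ~ monochromatic chi T.

Definition homothetic_copy (R : realType) (L : set 'cV[R]_2) (c : 'cV[R]_2)
    (lam : R) : set 'cV[R]_2 :=
  [set c + lam *: x | x in L].

(* Main.v *)
Require Import Defs.
From mathcomp Require Import all_boot all_order all_algebra.
From mathcomp Require Import all_classical all_reals all_analysis.
From mathcomp Require Import ring lra.

Set Implicit Arguments.
Unset Strict Implicit.
Unset Printing Implicit Defensive.

Import Order.TTheory GRing.Theory Num.Theory.
Import numFieldNormedType.Exports.

Local Open Scope classical_set_scope.
Local Open Scope ring_scope.

(** By Gallai's theorem some homothetic copy [c + l F] of a large finite piece
    [F] of the lattice (all its points in a big disc) is monochromatic, with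
    [l] bounded.  Since [s0] is extreme, [S - s0] lies in an open half-plane,
    and rotatability gives finitely many similarities of the lattice into
    itself turning that half-plane towards any prescribed direction.  So a
    lattice point [p] just outside a large disc is the apex of a similar copy
    of [(S, s0)] whose other points are closer to the origin by a definite
    amount.  If no copy is almost-monochromatic, the colour of the disc
    therefore spreads outwards to the whole of [c + l L]. *)

(** * Gallai's theorem by colour focusing *)

(* The finite window [D] for [c] is what lets the induction treat the colour
   pattern on a window as a single colour from a finite set. *)
Definition gallai_property (V : zmodType) (F : seq V) : Prop :=
  forall C : finType, exists (D : seq V) (N : nat), forall chi : V -> C,
  exists (c : V) (l : nat), [/\ c \in D, (0 < l <= N)%N &
    {in F &, forall f g, chi (c + f *+ l) = chi (c + g *+ l)}].

(* Colour focusing: the copies [a + p.1 F], [p] in [s], are monochromatic with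
   pairwise distinct colours [p.2] and share the focus [a]; once there are
   [#|C|] of them the colour of [a] must be one of theirs. *)
Lemma color_focusing (V : zmodType) (F : seq V) (C : finType) (r : nat) :
  gallai_property F ->
  exists (B : seq V) (N : nat), forall chi : V -> C,
    (exists (a : V) (l : nat), [/\ a \in B, (0 < l <= N)%N &
       {in F, forall f, chi (a + f *+ l) = chi a}]) \/
    (exists (a : V) (s : seq (nat * C)),
      [/\ a \in B, size s = r, uniq (chi a :: map snd s) &
        {in s, forall p, (0 < p.1 <= N)%N /\
          {in F, forall f, chi (a + f *+ p.1) = p.2}}]).
Proof.
move=> galF; elim: r => [|r [B [N HB]]].
  by exists [:: 0], 0%N => chi; right; exists 0, [::]; rewrite mem_head.
(* [W] holds every point whose colour the induction hypothesis inspects, so the pattern on [W] is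
   one colour of a finite type. *)
pose G := 0 :: [seq f *+ l | f <- F, l <- iota 0 N.+1].
pose W := [seq a + g | a <- B, g <- G].
have W0 a : a \in B -> a \in W.
  by move=> aB; apply/allpairsP; exists (a, 0); rewrite mem_head addr0.
have WF a f l : a \in B -> f \in F -> (l <= N)%N -> a + f *+ l \in W.
  move=> aB fF lN; apply/allpairsP; exists (a, f *+ l); split=> //.
  rewrite inE; apply/orP; right; apply/allpairsP; exists (f, l).
  by rewrite mem_iota.
have [D [M HD]] := galF {ffun 'I_(size W) -> C}.
(* The patterns at [c + f *+ l] agree, so any member of [F] serves as reference; for empty [F] the
   default 0 is never compared. *)
pose f0 := head 0 F.
have f0F f : f \in F -> f0 \in F.
  by rewrite /f0; case: (F) => //= *; exact: mem_head.
exists ([seq d + a | d <- D, a <- B] ++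
        [seq d + f0 *+ l.1 + l.2 |
           d <- D, l <- [seq (i, a) | i <- iota 0 M.+1, a <- B]]).
exists (N + M)%N => chi.
have [c [l [cD /andP[l0 lM] Hc]]] :=
  HD (fun x => [ffun i : 'I_(size W) => chi (x + nth 0 W i)]).
pose psi w := chi (c + f0 *+ l + w).
have Hpsi f w : f \in F -> w \in W -> chi (c + f *+ l + w) = psi w.
  move=> fF wW; have wl : (index w W < size W)%N by rewrite index_mem.
  move: (Hc f f0 fF (f0F _ fF)) => /ffunP /(_ (Ordinal wl)).
  by rewrite !ffunE /= nth_index.
case: (HB psi) => [[a [m [aB /andP[m0 mN] Ha]]]|[a [s [aB ss us Hs]]]].
  left; exists (c + f0 *+ l + a), m; split.
  - rewrite mem_cat; apply/orP; right; apply/allpairsP; exists (c, (l, a)).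
    by split=> //; apply/allpairsP; exists (l, a); rewrite mem_iota.
  - by rewrite m0 (leq_trans mN) ?leq_addr.
  - by move=> f fF; rewrite -addrA; exact: Ha.
have bB : c + a \in [seq d + a | d <- D, a <- B].
  by apply/allpairsP; exists (c, a).
(* If the focus has a colour already in use, it matches that copy; otherwise the copy of ratio [l]
   joins the old ones, whose ratios grow by [l]. *)
case: (boolP (chi (c + a) \in psi a :: map snd s)) => [|nin].
  rewrite inE => /orP[/eqP e|/mapP[[m k] ms /= e]].
    left; exists (c + a), l; split.
    - by rewrite mem_cat bB.
    - by rewrite l0 (leq_trans lM) ?leq_addl.
    - by move=> f fF; rewrite addrAC Hpsi ?e// W0.
  have [/andP[/= m0 mN] Hm] := Hs _ ms.
  left; exists (c + a), (l + m)%N; split.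
  - by rewrite mem_cat bB.
  - by rewrite addn_gt0 l0 addnC leq_add.
  (* The point is [a + f *+ m] seen in the window at [c + f *+ l]. *)
  - move=> f fF; rewrite mulrnDr addrACA Hpsi// ?e -?(Hm f)//.
    exact: WF.
right; exists (c + a), ((l, psi a) :: [seq ((l + p.1)%N, p.2) | p <- s]); split.
- by rewrite mem_cat bB.
- by rewrite /= size_map ss.
- by rewrite /= -map_comp (eq_map (g := snd)) // nin.
- move=> p; rewrite inE => /orP[/eqP ->|/mapP[[m k] ms ->]] /=.
    rewrite l0 (leq_trans lM) ?leq_addl; split=> // f fF.
    by rewrite addrAC Hpsi ?W0.
  have [/andP[/= m0 mN] Hm] := Hs _ ms.
  rewrite addn_gt0 l0 [(N + M)%N]addnC leq_add//; split=> // f fF.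
  by rewrite mulrnDr addrACA Hpsi ?Hm ?WF.
Qed.

(** Translating by [- f] puts [f] at the focus. A focus and [#|C|] copies of distinct colours would
    use [#|C| + 1] colours, so the focus matches a copy of the remaining points; shifting back by
    [f *+ l] gives the copy of [f :: F]. *)
Theorem gallai (V : zmodType) (F : seq V) : gallai_property F.
Proof.
have [n] := ubnP (size F); elim: n F => // n IHn [_ C|f F /ltnSE sF C].
  by exists [:: 0], 1%N => chi; exists 0, 1%N; rewrite mem_head.
have galF : gallai_property [seq g - f | g <- F] by apply: IHn; rewrite size_map.
have [B [N HB]] := color_focusing C #|C| galF.
exists [seq a - f *+ l | a <- B, l <- iota 0 N.+1], N => chi.
case: (HB chi) => [[a [l [aB /andP[l0 lN] Ha]]]|[a [s [_ ss us _]]]]; last first.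
  by have := card_uniqP us; have := max_card (mem (chi a :: map snd s));
     move=> /[swap] ->; rewrite /= size_map ss ltnn.
exists (a - f *+ l), l; split; last 2 first.
- by rewrite l0.
- have Hg g : g \in f :: F -> chi (a - f *+ l + g *+ l) = chi a.
    rewrite inE => /orP[/eqP ->|gF]; first by rewrite subrK.
    rewrite -(Ha (g - f)); last by apply/mapP; exists g.
    by rewrite mulrnBl addrAC -addrA.
  by move=> g h /Hg -> /Hg ->.
- by apply/allpairsP; exists (a, l); rewrite mem_iota.
Qed.

(** * Separating an extreme point from the other points by a linear form *)

Definition dot (R : realType) (x y : 'cV[R]_2) : R :=
  x 0 0 * y 0 0 + x 1 0 * y 1 0.

Lemma dot_ge0 (R : realType) (x : 'cV[R]_2) : 0 <= dot x x.
Proof. by rewrite /dot -!expr2 addr_ge0 ?sqr_ge0. Qed.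

Lemma colvec2P (R : realType) (x y : 'cV[R]_2) :
  x 0 0 = y 0 0 -> x 1 0 = y 1 0 -> x = y.
Proof.
move=> h0 h1; apply/matrixP => i j; rewrite ord1.
by case: i => [[|[|[]]] // i]; [move: h0|move: h1]; congr (x _ _ = y _ _);
  exact: val_inj.
Qed.

Lemma finite_between (R : realType) (A B : seq R) :
  {in A & B, forall a b, a < b} ->
  exists y, {in A, forall a, a < y} /\ {in B, forall b, y < b}.
Proof.
elim: A => [_|a A IHA AB].
  elim: B => [|b B [y [_ yB]]]; first by exists 0.
  exists (Num.min y (b - 1)); split=> // c; rewrite inE => /orP[/eqP ->|/yB yc].
    by rewrite gt_min (_ : b - 1 < b) ?orbT//; lra.
  by rewrite gt_min yc.
have [y [Ay yB]] : exists y, {in A, forall a, a < y} /\ {in B, forall b, y < b}.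
  by apply: IHA => c b cA bB; apply: AB; rewrite // inE cA orbT.
have {}AB b : b \in B -> a < b by apply: AB; exact: mem_head.
case: (ltP a y) => ay.
  by exists y; split=> // c; rewrite inE => /orP[/eqP ->|/Ay].
have [z [az zB]] : exists z, a < z /\ {in B, forall b, z < b}.
  elim: B AB {IHA yB} => [_|b B IHB AB]; first by exists (a + 1); split=> //; lra.
  have [z [az zB]] : exists z, a < z /\ {in B, forall b, z < b}.
    by apply: IHB => c cB; apply: AB; rewrite inE cB orbT.
  have ab := AB b (mem_head _ _).
  exists (Num.min z ((a + b) / 2)); split.
    by rewrite lt_min az; lra.
  move=> c; rewrite inE => /orP[/eqP ->|/zB zc]; last by rewrite gt_min zc.
  by rewrite gt_min; apply/orP; right; lra.
exists z; split=> // c; rewrite inE => /orP[/eqP ->//|/Ay cy].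
exact: lt_trans cy (le_lt_trans ay az).
Qed.

(* Fourier-Motzkin elimination: the signs on the horizontal axis fix the first
   coordinate of [u], the second must lie between finitely many bounds. *)
Lemma cone_separation (R : realType) (K : set 'cV[R]_2) (s : seq 'cV[R]_2) :
  (forall x y, K x -> K y -> K (x + y)) ->
  (forall t x, 0 < t -> K x -> K (t *: x)) -> ~ K 0 ->
  {in s, forall w, K w} -> exists u, {in s, forall w, 0 < dot u w}.
Proof.
move=> KD KZ K0 sK.
(* Two such vectors have a positive combination equal to 0, unless the second is itself 0. *)
have Kaxis (x y : 'cV[R]_2) : K x -> K y -> x 1 0 = 0 -> y 1 0 = 0 ->
    x 0 0 < 0 -> 0 <= y 0 0 -> False.
  move=> Kx Ky x1 y1 x0 y0; apply: K0.
  have [y00|y00] := eqVneq (y 0 0) 0.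
    by rewrite (_ : 0 = y) //; apply: colvec2P; rewrite ?mxE.
  rewrite (_ : 0 = y 0 0 *: x + (- x 0 0) *: y); last first.
    by apply: colvec2P; rewrite !mxE ?x1 ?y1; ring.
  by apply: KD; apply: KZ => //; lra.
have [e He] : exists e : R, forall x, K x -> x 1 0 = 0 -> 0 < e * x 0 0.
  case: (pselect (exists x, [/\ K x, x 1 0 = 0 & x 0 0 < 0])) => [[x [Kx x1 x0]]|no].
    exists (-1) => y Ky y1; rewrite mulN1r oppr_gt0 ltNge; apply/negP => y0.
    exact: (Kaxis x y).
  exists 1 => y Ky y1; rewrite mul1r lt_neqAle; apply/andP; split.
    apply/eqP => y0; apply: K0.
    by rewrite (_ : 0 = y) //; apply: colvec2P; rewrite ?mxE.
  by rewrite leNgt; apply/negP => y0; apply: no; exists y.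
(* The root in [y] of [e * w 0 0 + y * w 1 0]: a lower bound for [y] if [w 1 0] is positive, an
   upper bound if it is negative. *)
pose f (w : 'cV[R]_2) := - (e * w 0 0) / w 1 0.
have [y [ly yr]] : exists y,
    {in [seq f w | w : 'cV[R]_2 <- s & 0 < w 1 0], forall a, a < y} /\
    {in [seq f w | w : 'cV[R]_2 <- s & w 1 0 < 0], forall b, y < b}.
  apply: finite_between => _ _ /mapP[w + ->] /mapP[z + ->].
  rewrite !mem_filter => /andP[w1 ws] /andP[z1 zs].
  have : 0 < e * ((- z 1 0) *: w + w 1 0 *: z) 0 0.
    apply: He; last by rewrite !mxE; ring.
    by apply: KD; apply: KZ; rewrite ?oppr_gt0//; apply: sK.
  rewrite !mxE => h; rewrite ltNge; apply/negP => fzw.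
  have fw : f w * w 1 0 = - (e * w 0 0) by rewrite divfK ?gt_eqF.
  have fz : f z * z 1 0 = - (e * z 0 0) by rewrite divfK ?lt_eqF.
  have : 0 <= (f w - f z) * (w 1 0 * - z 1 0).
    by rewrite mulr_ge0 ?subr_ge0 // mulr_ge0 ?oppr_ge0 ?ltW.
  rewrite leNgt => /negP; apply.
  have -> : (f w - f z) * (w 1 0 * - z 1 0) =
    - (f w * w 1 0) * z 1 0 + (f z * z 1 0) * w 1 0 by ring.
  by rewrite fw fz; lra.
exists (\matrix_(i, j) if i == 0 then e else y) => w ws.
rewrite /dot !mxE /=.
case: (ltgtP (w 1 0) 0) => w1.
- have : y < f w by apply: yr; apply/mapP; exists w; rewrite // mem_filter w1.
  by rewrite /f ltr_ndivlMr // => h; lra.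
- have : f w < y by apply: ly; apply/mapP; exists w; rewrite // mem_filter w1.
  by rewrite /f ltr_pdivrMr // => h; lra.
- by rewrite w1 mulr0 addr0; apply: He => //; exact: sK.
Qed.

Lemma convex_hullW (R : realType) (A : set 'cV[R]_2) (x y : 'cV[R]_2) (p : R) :
  0 <= p -> p <= 1 -> convex_hull A x -> convex_hull A y ->
  convex_hull A (p *: x + (1 - p) *: y).
Proof.
move=> p0 p1 hx hy B [cB AB].
have := cB x y (Itv01 p0 p1); rewrite !inE; apply.
- exact: hx.
- exact: hy.
Qed.

(** The directions leading from [s0] into the hull of the other points form a convex cone, which
    contains 0 only if [s0] lies in that hull. *)
Lemma extreme_point_separation (R : realType) (S : set 'cV[R]_2) s0 :
  finite_set S -> extreme_point S s0 ->
  exists u, forall s, S s -> s <> s0 -> 0 < dot u (s - s0).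
Proof.
move=> /finite_seqP[s ->] [_ ext].
set A := (X in convex_hull X) in ext.
pose K := [set x | exists2 t, 0 < t & convex_hull A (s0 + t *: x)].
have [||||u Hu] := @cone_separation R K [seq x - s0 | x <- s & x != s0].
(* This scale makes the new point the mean of the two given ones with weights [r / (t + r)] and
   [t / (t + r)]. *)
- move=> x y [t t0 hx] [r r0 hy]; exists (t * r / (t + r)).
    by rewrite divr_gt0 ?mulr_gt0 ?addr_gt0.
  have tr : t + r != 0 by rewrite gt_eqF ?addr_gt0.
  have -> : s0 + (t * r / (t + r)) *: (x + y) =
     (r / (t + r)) *: (s0 + t *: x) + (1 - r / (t + r)) *: (s0 + r *: y).
    by apply: colvec2P; rewrite !mxE; field.
  apply: convex_hullW => //; first by rewrite divr_ge0 ?addr_ge0 ?ltW.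
  by rewrite ler_pdivrMr ?addr_gt0// mul1r lerDr ltW.
- move=> t x t0 [r r0 hx]; exists (r / t); first exact: divr_gt0.
  by rewrite scalerA divfK ?gt_eqF.
- by move=> [t _]; rewrite scaler0 addr0.
- move=> _ /mapP[x + ->]; rewrite mem_filter => /andP[xs0 xs].
  exists 1 => //; rewrite scale1r addrC subrK.
  by apply: sub_gen_smallest; split=> //; exact/eqP.
exists u => x xs xs0; apply: Hu; apply/mapP; exists x => //.
by rewrite mem_filter xs andbT; exact/eqP.
Qed.

(** * Rotations and similarities pulling points towards the origin *)

(** The sign [i] moves the lower half-plane to the upper one, keeping the angle in [[0, pi]], the
    range that rotatability covers. *)
Lemma polar_coordinates (R : realType) (a b : R) :
  exists (t r : R) (i : bool), [/\ 0 <= t <= pi, 0 <= r, r ^+ 2 = a ^+ 2 + b ^+ 2,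
    a = (-1) ^+ i * r * cos t & b = (-1) ^+ i * r * sin t].
Proof.
have ab0 : 0 <= a ^+ 2 + b ^+ 2 by rewrite addr_ge0 ?sqr_ge0.
pose r := Num.sqrt (a ^+ 2 + b ^+ 2).
have r2 : r ^+ 2 = a ^+ 2 + b ^+ 2 by rewrite sqr_sqrtr.
have [r0|r0] := eqVneq r 0.
  have /eqP : a ^+ 2 + b ^+ 2 = 0 by rewrite -r2 r0 expr0n.
  rewrite paddr_eq0 ?sqr_ge0// !sqrf_eq0 => /andP[/eqP a0 /eqP b0].
  exists 0, r, false; split; rewrite ?lexx ?pi_ge0 ?r0 ?sqrtr_ge0 //.
  - by rewrite a0 b0; ring.
  - by rewrite a0; ring.
  - by rewrite b0; ring.
pose i := b < 0; pose c := (-1) ^+ i * a / r; pose d := (-1) ^+ i * b / r.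
have cd : c ^+ 2 + d ^+ 2 = 1.
  rewrite /c /d !exprMn -!mulrDl -!mulrDr exprVn -r2 sqrr_sign mul1r.
  by rewrite divff // sqrf_eq0.
have d0 : 0 <= d.
  apply: divr_ge0; last exact: sqrtr_ge0.
  rewrite /i; case: (ltP b 0) => b0; rewrite ?expr1 ?expr0; lra.
have c1 : -1 <= c <= 1.
  by apply/andP; split; nra.
have sK x : x = (-1) ^+ i * r * ((-1) ^+ i * x / r).
  by rewrite mulrACA divff // mulr1 mulrA -expr2 sqrr_sign mul1r.
exists (acos c), r, i; split=> //.
- by rewrite acos_ge0 ?acos_lepi.
- exact: sqrtr_ge0.
- by rewrite acosK // sK.
- rewrite sin_acos // (_ : 1 - c ^+ 2 = d ^+ 2); last lra.
  by rewrite sqrtr_sqr ger0_norm // sK.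
Qed.

(** Continuity at 0, made uniform by finiteness. In the application the expression is the dot
    product of a vector with a fixed one turned by [t]. *)
Lemma small_rotation_pos (R : realType) (s : seq (R * R)) :
  {in s, forall x : R * R, 0 < x.1} ->
  exists eta del : R, [/\ 0 < eta, 0 < del & {in s, forall (x : R * R) t,
    `|t| < del -> eta <= cos t * x.1 + sin t * x.2}].
Proof.
elim: s => [_|[x y] s IHs sP]; first by exists 1, 1.
have [|eta [del [eta0 del0 H]]] := IHs.
  by move=> z zs; apply: sP; rewrite inE zs orbT.
have x0 : 0 < x := sP (x, y) (mem_head _ _).
have : (fun t => cos t * x + sin t * y) @ (0 : R) --> cos 0 * x + sin 0 * y.
  by apply: cvgD; apply: cvgM; (exact: cvg_cst || exact: continuous_cos || exact: continuous_sin).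
rewrite cos0 sin0 mul0r addr0 mul1r => /cvgr_gt /(_ (x / 2)) [|/= e e0 He]; first by lra.
exists (Num.min eta (x / 2)), (Num.min del e); split.
- by rewrite lt_min eta0; lra.
- by rewrite lt_min del0.
- move=> z zs t; rewrite lt_min => /andP[td te]; rewrite ge_min.
  move: zs; rewrite inE => /orP[/eqP ->|zs]; last by rewrite H.
  by apply/orP; right; apply/ltW/He; rewrite /ball /= sub0r normrN.
Qed.

Lemma rotationE (R : realType) (a : R) (x : 'cV[R]_2) :
  ((rotation_mx a *m x) 0 0 = cos a * x 0 0 - sin a * x 1 0) *
  ((rotation_mx a *m x) 1 0 = sin a * x 0 0 + cos a * x 1 0).
Proof.
by split; rewrite !mxE !big_ord_recl big_ord0 !mxE /= addr0 ?mulNr //;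
   rewrite (_ : lift ord0 ord0 = 1) //; exact: val_inj.
Qed.

Lemma subdivision_cell (R : realType) (h t : R) (m : nat) :
  (0 < m)%N -> 0 <= t <= m%:R * h ->
  exists j : 'I_m, j%:R * h <= t <= j.+1%:R * h.
Proof.
elim: m => // m IHm _ /andP[t0 th].
have [tm|tm] := leP (m%:R * h) t; first by exists ord_max; rewrite tm.
have m0 : (0 < m)%N by case: (m) tm => //; rewrite mul0r ltNge t0.
have [|j Hj] := IHm m0; first by rewrite t0 ltW.
by exists (widen_ord (leqnSn m) j).
Qed.

Lemma seq_bounded (R : realType) (T : eqType) (s : seq T) (f : T -> R) :
  exists M, {in s, forall x : T, f x <= M}.
Proof.
elim: s => [|x s [M HM]]; first by exists 0.
exists (Num.max (f x) M) => y; rewrite inE le_max => /orP[/eqP ->|/HM ->].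
  by rewrite lexx.
by rewrite orbT.
Qed.

(* Rotatability only provides angles in [(0, pi)]; the sign [i] covers the
   other half-turn. *)
Lemma inward_similarities (R : realType) (L : set 'cV[R]_2) (W : seq 'cV[R]_2)
    (u : 'cV[R]_2) :
  rotatable L -> u != 0 -> {in W, forall w, 0 < dot u w} ->
  exists (m : nat) (lam al : 'I_m -> R) (rho : R),
    [/\ forall j, 0 < lam j,
        forall j x, L x -> L (lam j *: (rotation_mx (al j) *m x)) &
        forall p, rho < dot p p -> exists (j : 'I_m) (i : bool), {in W, forall w : 'cV[R]_2,
          let q := p + (-1) ^+ i *: (lam j *: (rotation_mx (al j) *m w)) in
          dot q q <= dot p p - 1}].
Proof.
move=> Lrot u0 uW.
(* [J w] is the dot product of [w] with [u] turned by a right angle. *)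
pose J (w : 'cV[R]_2) := u 0 0 * w 1 0 - u 1 0 * w 0 0.
have [|eta [del [eta0 del0 Hdel]]] :=
  @small_rotation_pos R [seq (dot u w, J w) | w <- W].
  by move=> _ /mapP[w wW ->]; exact: uW.
have uu : 0 < dot u u.
  rewrite lt_neqAle dot_ge0 andbT eq_sym; apply: contra u0.
  rewrite /dot -!expr2 paddr_eq0 ?sqr_ge0// !sqrf_eq0 => /andP[/eqP h0 /eqP h1].
  by apply/eqP/colvec2P; rewrite mxE.
have [m m0 hdel] : exists2 m, (0 < m)%N & pi / m%:R < del :> R.
  exists (Num.truncn (pi / del)).+1 => //.
  rewrite ltr_pdivrMr // mulrC -ltr_pdivrMr //.
  exact: truncnS_gt.
have mR : 0 < m%:R :> R by rewrite ltr0n.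
pose h : R := pi / m%:R.
have h0 : 0 < h by rewrite divr_gt0 ?pi_gt0.
(* An angle inside each of the [m] cells of [[0, pi]] is within [del] of every angle of its cell. *)
have /choice[al /choice[lam Hal]] : forall j : 'I_m, exists al lam : R,
    [/\ j%:R * h < al < j.+1%:R * h, 0 < lam &
      [set lam *: (rotation_mx al *m x) | x in L] `<=` L].
  move=> j; apply: Lrot.
  - by rewrite mulr_ge0 ?ler0n ?ltW.
  - by rewrite ltr_pM2r // ltr_nat.
  - by rewrite mulrA ler_pdivrMr // mulrC ler_pM2l ?pi_gt0 // ler_nat.
have lam0 j : 0 < lam j by have [] := Hal j.
have [Q HQ] := seq_bounded W (fun w => dot w w).
pose Q' := Num.max Q 0.
(* From radius [r0 j] on, the gain [2 * r * lam j * eta] exceeds the loss [lam j ^+ 2 * Q'] by at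
   least 1. *)
pose r0 j := (1 + lam j ^+ 2 * Q') / (2 * lam j * eta).
have Q0 : 0 <= Q' by rewrite le_max lexx orbT.
have r00 j : 0 <= r0 j.
  by rewrite divr_ge0 ?addr_ge0 ?mulr_ge0 ?sqr_ge0 // ltW.
exists m, lam, al, ((\sum_j r0 j) ^+ 2 * dot u u); split=> // [j x Lx|p Hp].
  by have [_ _] := Hal j; apply; exists x.
(* In the frame of [u] and its quarter turn, [p] is [(-1) ^+ i * r] times [u] turned by [t]; hence
   the factor [dot u u] in the threshold. *)
have [t [r [i [t0pi r_ge0 r2 ha hb]]]] :=
  polar_coordinates (dot u p / dot u u) (J p / dot u u).
have pE0 : p 0 0 = (-1) ^+ i * r * (cos t * u 0 0 - sin t * u 1 0).
  transitivity (dot u p / dot u u * u 0 0 - J p / dot u u * u 1 0).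
    by rewrite /dot /J; field; exact: lt0r_neq0.
  by rewrite ha hb; ring.
have pE1 : p 1 0 = (-1) ^+ i * r * (cos t * u 1 0 + sin t * u 0 0).
  transitivity (dot u p / dot u u * u 1 0 + J p / dot u u * u 0 0).
    by rewrite /dot /J; field; exact: lt0r_neq0.
  by rewrite ha hb; ring.
have pp : dot p p = r ^+ 2 * dot u u.
  rewrite {1}/dot pE0 pE1.
  transitivity (((-1) ^+ i) ^+ 2 * r ^+ 2 * (cos t ^+ 2 + sin t ^+ 2) * dot u u).
    by rewrite /dot; ring.
  by rewrite sqrr_sign cos2Dsin2; ring.
have [j /andP[jt tj]] : exists j : 'I_m, j%:R * h <= t <= j.+1%:R * h.
  by apply: subdivision_cell => //; rewrite mulrC divfK ?gt_eqF.
(* The sign opposite to that of [p] points the copy back towards the origin. *)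
exists j, (~~ i) => w wW.
set q := p + _.
have [/andP[ja aj] _ _] := Hal j.
have tal : `|t - al j| < del.
  rewrite ltr_norml; move: aj tj; rewrite -natr1 mulrDl mul1r.
  by move: hdel; rewrite -/h => *; apply/andP; split; lra.
have /= := Hdel _ (map_f (fun w => (dot u w, J w)) wW) _ tal.
rewrite cosB sinB => Hw.
have rr : r0 j <= r.
  apply: (@le_trans _ _ (\sum_j r0 j)).
    by rewrite (bigD1 j) //= lerDl sumr_ge0.
  rewrite -ler_sqr ?nnegrE ?sumr_ge0 // -(ler_pM2r uu) -pp.
  exact: ltW.
have {rr} : 1 + lam j ^+ 2 * Q' <= r * (2 * lam j * eta).
  by rewrite -ler_pdivrMr // !mulr_gt0.
have ww : dot w w <= Q' by rewrite le_max HQ.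
set s := (-1) ^+ i in pE0 pE1 *.
have s2 : s ^+ 2 = 1 by rewrite sqrr_sign.
(* Law of cosines; the bracket is the dot product of [w] with [u] turned by [t - al j], at least
   [eta] by [Hw]. *)
have -> : dot q q = dot p p - s ^+ 2 * 2 * r * lam j *
   ((cos t * cos (al j) + sin t * sin (al j)) * dot u w +
    (sin t * cos (al j) - cos t * sin (al j)) * J w) +
   s ^+ 2 * lam j ^+ 2 * (cos (al j) ^+ 2 + sin (al j) ^+ 2) * dot w w.
  have sN : (-1) ^+ (~~ i) = - s by rewrite signrN.
  have [v0 v1] := rotationE (al j) w; rewrite /q.
  move: (rotation_mx _ *m w) v0 v1 => v v0 v1.
  by rewrite /dot sN !mxE v0 v1 pE0 pE1 /J; ring.
rewrite s2 cos2Dsin2 => H.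
have : lam j ^+ 2 * dot w w <= lam j ^+ 2 * Q' by rewrite ler_pM2l ?exprn_gt0.
have : 2 * r * lam j * eta <= 2 * r * lam j *
   ((cos t * cos (al j) + sin t * sin (al j)) * dot u w +
    (sin t * cos (al j) - cos t * sin (al j)) * J w).
  by rewrite ler_wpM2l // !mulr_ge0 // ltW.
move=> *; lra.
Qed.

(** * Integer coordinates and finiteness of discs in the lattice *)

(** The coordinates form the additive group [int * int] to which Gallai's theorem is applied. *)
Definition lattice_point (R : realType) (v1 v2 : 'cV[R]_2) (n : int * int) : 'cV[R]_2 :=
  v1 *~ n.1 + v2 *~ n.2.

Lemma lattice_pointD (R : realType) (v1 v2 : 'cV[R]_2) (m n : int * int) :
  lattice_point v1 v2 (m + n) = lattice_point v1 v2 m + lattice_point v1 v2 n.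
Proof. by rewrite /lattice_point /= !mulrzDr addrACA. Qed.

Lemma lattice_pointN (R : realType) (v1 v2 : 'cV[R]_2) (n : int * int) :
  lattice_point v1 v2 (- n) = - lattice_point v1 v2 n.
Proof. by rewrite /lattice_point /= !mulrNz opprD. Qed.

Lemma lattice_pointMn (R : realType) (v1 v2 : 'cV[R]_2) (n : int * int) (l : nat) :
  lattice_point v1 v2 (n *+ l) = l%:R *: lattice_point v1 v2 n.
Proof.
rewrite scaler_nat; elim: l => [|l IHl]; last by rewrite !mulrS lattice_pointD IHl.
by rewrite !mulr0n /lattice_point !mulr0z addr0.
Qed.

Lemma free2_det (R : realType) (v1 v2 : 'cV[R]_2) :
  free [:: v1; v2] -> v1 0 0 * v2 1 0 - v1 1 0 * v2 0 0 != 0.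
Proof.
rewrite free_cons seq1_free span_seq1 => /andP[/negP v12 v2n0].
apply/negP => /eqP d0; apply: v12; apply/vlineP.
have [v20|v20] := eqVneq (v2 0 0) 0; last first.
  exists (v1 0 0 / v2 0 0); apply: colvec2P; rewrite !mxE ?divfK //.
  by apply: (mulIf v20); rewrite mulrAC divfK //; lra.
have v21 : v2 1 0 != 0.
  by apply: contra v2n0 => /eqP v21; apply/eqP/colvec2P; rewrite mxE.
exists (v1 1 0 / v2 1 0); apply: colvec2P; rewrite !mxE ?divfK //.
by apply: (mulIf v21); rewrite mulrAC divfK //; lra.
Qed.

Lemma int_sqr_bounded (R : realType) (K : R) :
  exists s : seq int, forall n : int, n%:~R ^+ 2 <= K -> n \in s.
Proof.
pose N := (Num.truncn K).+1.
exists ([seq Posz i | i <- iota 0 N] ++ [seq - Posz i | i <- iota 0 N]) => n nK.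
have nN : (`|n| < N)%N.
  have [->//|n0] := posnP `|n|%N.
  have : `|n|%:R < N%:R :> R.
    apply: le_lt_trans (truncnS_gt K); apply: le_trans nK.
    rewrite natr_absz intr_norm -[X in _ <= X]real_normK ?num_real //.
    rewrite expr2 ler_peMl // -intr_norm ler1z -gtz0_ge1 normr_gt0 -absz_gt0.
    exact: n0.
  by rewrite ltr_nat.
rewrite mem_cat; case: (intP n) nN => [|i|i]; rewrite ?abszN ?absz_nat => nN.
- by rewrite map_f // mem_iota.
- by rewrite map_f // mem_iota.
- by apply/orP; right; apply/mapP; exists i.+1; rewrite // mem_iota.
Qed.

(** By Cramer's rule each coordinate times [d] is, up to sign, a cross product with [v1] or [v2].
    Cauchy-Schwarz bounds it; the defect is the square of a dot product. *)
Lemma lattice_ball_finite (R : realType) (v1 v2 : 'cV[R]_2) (rho : R) :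
  free [:: v1; v2] -> exists F : seq (int * int), forall n,
    dot (lattice_point v1 v2 n) (lattice_point v1 v2 n) <= rho -> n \in F.
Proof.
move=> /free2_det; set d := _ - _ => d0.
have d2 : 0 < d ^+ 2 by rewrite exprn_even_gt0.
have [s1 Hs1] := int_sqr_bounded (rho * dot v2 v2 / d ^+ 2).
have [s2 Hs2] := int_sqr_bounded (rho * dot v1 v1 / d ^+ 2).
exists [seq (a, b) | a <- s1, b <- s2] => -[a b] Hx.
have xE i : lattice_point v1 v2 (a, b) i 0 = a%:~R * v1 i 0 + b%:~R * v2 i 0.
  by rewrite /lattice_point /= -[v1 *~ a]scaler_int -[v2 *~ b]scaler_int !mxE.
apply/allpairsP; exists (a, b); split=> //=; [apply: Hs1|apply: Hs2].
- rewrite ler_pdivlMr //; apply: le_trans (ler_wpM2r (dot_ge0 v2) Hx).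
  rewrite {1}/dot !xE -subr_ge0.
  set t := (X in 0 <= X).
  suff -> : t = ((a%:~R * v1 0 0 + b%:~R * v2 0 0) * v2 0 0 +
                 (a%:~R * v1 1 0 + b%:~R * v2 1 0) * v2 1 0) ^+ 2 by exact: sqr_ge0.
  by rewrite /t /d /dot; ring.
- rewrite ler_pdivlMr //; apply: le_trans (ler_wpM2r (dot_ge0 v1) Hx).
  rewrite {1}/dot !xE -subr_ge0.
  set t := (X in 0 <= X).
  suff -> : t = ((a%:~R * v1 0 0 + b%:~R * v2 0 0) * v1 0 0 +
                 (a%:~R * v1 1 0 + b%:~R * v2 1 0) * v1 1 0) ^+ 2 by exact: sqr_ge0.
  by rewrite /t /d /dot; ring.
Qed.

(** * Spreading the colour over a homothetic copy of the lattice *)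

Lemma orthogonal_sign_rotation (R : realType) (i : bool) (a : R) :
  orthogonal_mx ((-1) ^+ i *: rotation_mx a).
Proof.
have cs := cos2Dsin2 a.
apply/matrixP => j l; rewrite !mxE !big_ord_recl big_ord0 !mxE.
by case: i; case: j => [[|[|[]]] // ?]; case: l => [[|[|[]]] // ?]; rewrite /= ?expr0 ?expr1; lra.
Qed.

(** A point other than [s0] forces the separating vector to be nonzero and later shows that a copy
    has two colours. *)
Lemma theorem5p2_fixed_point (R : realType) (L S : set 'cV[R]_2) (s0 : 'cV[R]_2)
    (k : nat) :
  is_lattice L -> rotatable L -> S `<=` L -> finite_set S ->
  (exists2 s, S s & s <> s0) -> extreme_point S s0 ->
  exists Lam : R, forall chi : L -> 'I_k,
    (exists (lam : R) (T : set 'cV[R]_2) (t0 : 'cV[R]_2),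
      [/\ lam <= Lam, similar_copy S s0 lam T t0, T `<=` L &
          almost_monochromatic chi T t0]) \/
    (exists (lam : nat) (c : 'cV[R]_2),
      [/\ (1 <= lam)%N, lam%:R <= Lam, homothetic_copy L c lam%:R `<=` L &
          monochromatic chi (homothetic_copy L c lam%:R)]).
Proof.
move=> [v1 [v2 [fv LE]]] Lrot SL finS [s1 Ss1 s10] ext.
have Ss0 : S s0 by case: ext.
have [u Hu] := extreme_point_separation finS ext.
have /finite_seqP[s SE] := finS.
pose W := [seq x - s0 | x <- s & x != s0].
have WP x : S x -> x <> s0 -> x - s0 \in W.
  move=> Sx /eqP x0; apply/mapP; exists x => //.
  by rewrite mem_filter x0; rewrite SE in Sx.
have u0 : u != 0.
  apply/eqP => u0; have := Hu _ Ss1 s10.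
  by rewrite u0 /dot !mxE !mul0r addr0 ltxx.
have [|m [lam [al [rho [lam0 lamL Hrho]]]]] := @inward_similarities R L W u Lrot u0.
  move=> _ /mapP[x + ->]; rewrite mem_filter => /andP[/eqP x0 xs].
  by apply: Hu; rewrite ?SE.
pose phi := lattice_point v1 v2.
have Lphi z : L (phi z) by rewrite LE; exists z.1, z.2.
have phiL x : L x -> exists z, x = phi z.
  by rewrite LE => -[a [b ->]]; exists (a, b).
have [F HF] := lattice_ball_finite rho fv.
(* Adjoining 0 lets the common colour be read at [c] itself. *)
have [D [N HD]] := gallai (0 :: F) 'I_k.
(* The ratios that occur are [l] and [l * lam j] with [l <= N]. *)
exists (N%:R * (1 + \sum_j lam j)) => chi.
have sum0 : 0 <= \sum_j lam j by rewrite sumr_ge0 // => j _; exact: ltW.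
pose col z : 'I_k := chi (SigSub (mem_set (Lphi z))).
have colE (x : L) z : val x = phi z -> chi x = col z.
  by move=> xz; congr chi; exact: val_inj.
have [c [l [_ /andP[l0 lN] Hcl]]] := HD col.
case: (pselect (exists (r : R) (T : set 'cV[R]_2) (t0 : 'cV[R]_2),
      [/\ r <= N%:R * (1 + \sum_j lam j), similar_copy S s0 r T t0, T `<=` L &
          almost_monochromatic chi T t0])) => [|noAM]; first by left.
right; exists l, (phi c).
have copyE z : phi c + l%:R *: phi z = phi (c + z *+ l).
  by rewrite /phi lattice_pointD lattice_pointMn.
have NR : (l%:R : R) <= N%:R by rewrite ler_nat.
suff mono z : col (c + z *+ l) = col (c + 0 *+ l).
  split=> //.
  - by rewrite (le_trans NR) // ler_peMr // lerDl.
  - by move=> _ [x /phiL[z ->] <-]; rewrite copyE.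
  - move=> x y [_ /phiL[z ->] xz] [_ /phiL[t ->] yt].
    by rewrite (colE x (c + z *+ l)) ?(colE y (c + t *+ l)) ?mono // -copyE.
have base t : dot (phi t) (phi t) <= rho -> col (c + t *+ l) = col (c + 0 *+ l).
  by move=> /HF tF; apply: Hcl; rewrite inE ?eqxx ?tF ?orbT.
(* The squared radius grows by 1 at each step, the decrease that [Hrho] guarantees. *)
suff grow n : forall t, dot (phi t) (phi t) <= rho + n%:R ->
    col (c + t *+ l) = col (c + 0 *+ l).
  apply: (grow (Num.truncn (dot (phi z) (phi z) - rho)).+1).
  by rewrite -lerBlDl ltW // truncnS_gt.
elim: n {z} => [|n IHn] z; first by rewrite addr0; exact: base.
have [/base//|zrho zn] := leP (dot (phi z) (phi z)) rho.
have [j [i Hq]] := Hrho _ zrho.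
apply: contrapT => colz; apply: noAM.
pose Q := (-1) ^+ i *: rotation_mx (al j).
(* The translation puts the apex at the point whose colour is assumed wrong. *)
pose f x := (l%:R * lam j) *: (Q *m x) +
  (phi (c + z *+ l) - (l%:R * lam j) *: (Q *m s0)).
have fs0 : f s0 = phi (c + z *+ l) by rewrite /f addrC subrK.
have fS x : S x -> x <> s0 -> exists y, f x = phi y /\ col y = col (c + 0 *+ l).
  move=> Sx x0.
  have [y Hy] : exists y, (-1) ^+ i *: (lam j *: (rotation_mx (al j) *m (x - s0))) = phi y.
    have [a xa] := phiL _ (SL _ Sx); have [b sb] := phiL _ (SL _ Ss0).
    have : L (x - s0).
      by rewrite xa sb /phi -lattice_pointN -lattice_pointD; exact: Lphi.
    move=> /(lamL j) /phiL [y ->].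
    (* [lamL] covers the rotation only; the sign is absorbed by negating coordinates. *)
    case: (i); last by exists y; rewrite expr0 scale1r.
    by exists (- y); rewrite expr1 scaleN1r /phi lattice_pointN.
  exists (c + (z + y) *+ l); split.
    have Qy : phi y = lam j *: (Q *m x) - lam j *: (Q *m s0).
      by rewrite -Hy mulmxBr /Q -!scalemxAl !scalerBr !scalerA [_ ^+ i * _]mulrC.
    rewrite -!copyE /f /phi lattice_pointD -/phi Qy -copyE.
    move: (phi c) (phi z) => C Z.
    by rewrite !scalerDr scalerN !scalerA [RHS]addrA [RHS]addrCA.
  (* The point [z + y] lies in the smaller disc, where the colour is already known. *)
  apply: IHn; rewrite /phi lattice_pointD -/phi -Hy.
  apply: le_trans (Hq _ (WP _ Sx x0)) _.
  by move: zn; rewrite -natr1; lra.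
exists (l%:R * lam j), (f @` S), (f s0); split.
- apply: ler_pM => //; first exact: ltW.
  by rewrite (bigD1 j) //= addrCA lerDl addr_ge0 // sumr_ge0 // => ? _; exact: ltW.
- split; first by rewrite mulr_gt0 // ltr0n.
  by exists Q; eexists; split; [exact: orthogonal_sign_rotation|reflexivity|reflexivity].
- move=> _ [x Sx <-]; have [->|/eqP x0] := eqVneq x s0; first by rewrite fs0.
  by have [y [-> _]] := fS _ Sx x0.
have monoE (x : L) : (f @` S `\ f s0) (val x) -> chi x = col (c + 0 *+ l).
  move=> [[t St tx] xf]; have t0 : t <> s0 by move=> t0; apply: xf; rewrite -tx t0.
  by have [y [fy <-]] := fS _ St t0; apply: colE; rewrite -tx.
split; first by move=> x y /monoE -> /monoE ->.
have [y [fy coly]] := fS _ Ss1 s10.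
move=> /(_ (SigSub (mem_set (Lphi (c + z *+ l)))) (SigSub (mem_set (Lphi y)))).
move=> H; apply: colz; rewrite -coly; apply: H => /=.
- by exists s0.
- by exists s1.
Qed.

Theorem theorem5p2 (R : realType) (L S : set 'cV[R]_2)
    (L_lattice : is_lattice L) (L_rotatable : rotatable L)
    (S_sub : S `<=` L) (S_fin : finite_set S)
    (S_two : exists s t : 'cV[R]_2, [/\ S s, S t & s <> t]) (k : nat) :
  exists Lam : R, forall s0 : 'cV[R]_2, extreme_point S s0 ->
  forall chi : L -> 'I_k,
    (exists (lam : R) (T : set 'cV[R]_2) (t0 : 'cV[R]_2),
      [/\ lam <= Lam, similar_copy S s0 lam T t0, T `<=` L &
          almost_monochromatic chi T t0]) \/
    (exists (lam : nat) (c : 'cV[R]_2),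
      [/\ (1 <= lam)%N, lam%:R <= Lam, homothetic_copy L c lam%:R `<=` L &
          monochromatic chi (homothetic_copy L c lam%:R)]).
Proof.
have two s0 : exists2 s, S s & s <> s0.
  have [s [t [Ss St st]]] := S_two.
  have [ss0|/eqP ss0] := eqVneq s s0; last by exists s.
  by exists t => // ts0; apply: st; rewrite ss0 ts0.
(* Points that are not extreme get the dummy constant 0; extreme ones lie in the finite [S], so a
   bound of [Lam] on [S] suffices. *)
have /choice[Lam HLam] : forall s0, exists Lam : R, extreme_point S s0 ->
    forall chi : L -> 'I_k,
    (exists (lam : R) (T : set 'cV[R]_2) (t0 : 'cV[R]_2),
      [/\ lam <= Lam, similar_copy S s0 lam T t0, T `<=` L &
          almost_monochromatic chi T t0]) \/
    (exists (lam : nat) (c : 'cV[R]_2),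
      [/\ (1 <= lam)%N, lam%:R <= Lam, homothetic_copy L c lam%:R `<=` L &
          monochromatic chi (homothetic_copy L c lam%:R)]).
  move=> s0; case: (pselect (extreme_point S s0)) => ext; last by exists 0.
  have [Lam HLam] := theorem5p2_fixed_point k L_lattice L_rotatable S_sub S_fin
    (two s0) ext.
  by exists Lam.
have /finite_seqP[s SE] := S_fin.
have [M HM] := seq_bounded s Lam.
exists M => s0 ext chi; have LM : Lam s0 <= M by apply: HM; case: ext; rewrite SE.
have [[lam [T [t0 [? ? ? ?]]]]|[lam [c [? ? ? ?]]]] := HLam s0 ext chi.
  by left; exists lam, T, t0; split=> //; exact: le_trans LM.
by right; exists lam, c; split=> //; exact: le_trans LM.
Qed.
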